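(* There exists a finitely generated group that is invariably generated (IG) but not finitely invariably generated (not FIG).
   Context: Write $s^g = g^{-1}sg$. A subset $S$ of a group $G$ invariably generates $G$ if for every function $S\to G$, $s\mapsto g_s$, the set of conjugates $\{s^{g_s} : s\in S\}$ generates $G$. A group $G$ is invariably generated (IG) if it has an invariably generating subset; equivalently, if the subset $S=G$ invariably generates $G$. A group is finitely invariably generated (FIG) if it has a finite invariably generating subset. *)

(* Defs.v *)
From mathcomp Require Import all_boot.
From mathcomp Require Import boolp classical_sets functions cardinality.

Set Implicit Arguments.
Unset Strict Implicit.
Unset Printing Implicit Defensive.

Local Open Scope group_scope.
Local Open Scope classical_set_scope.

Section Generation.
Context {G : groupType}.
Implicit Type S : set G.

Definition generated S : set G :=
  smallest [set H : set G | group_closed [in H]] S.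

Definition generates S := generated S = [set: G].

(* A function defined on S is represented by a total function g : G -> G; only
   its values on S matter.  In monoid.v, x ^ y is y^-1 * (x * y). *)
Definition invariably_generates S :=
  forall g : G -> G, generates [set s ^ g s | s in S].

End Generation.

Definition finitely_generated (G : groupType) :=
  exists2 S : set G, finite_set S & generates S.

Definition invariably_generated (G : groupType) :=
  exists S : set G, invariably_generates S.

Definition finitely_invariably_generated (G : groupType) :=
  exists2 S : set G, finite_set S & invariably_generates S.

(* Main.v *)
From HB Require Import structures.
From mathcomp Require Import all_boot all_order all_algebra fingroup perm.
From mathcomp Require cyclic alt.
From mathcomp Require Import boolp classical_sets functions cardinality.
From mathcomp Require Import zify.
Require Import Defs.

Set Implicit Arguments.
Unset Strict Implicit.
Unset Printing Implicit Defensive.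

Local Open Scope group_scope.
Local Open Scope classical_set_scope.

(** Let [W] be the following wreath product over countably many levels: an
    element consists of a translation [m] of the integers and, for each level
    [n] and each site [j], a permutation [k n j] in S_3.  Such an element acts
    on [Z * {0,1,2}], at level [n], by [(j, y) |-> (j + m, k n j y)].  Put
    [a = (1 2)] and [b = (0 1)], and let [G] be generated by the unit
    translation [t] and by the element [s] without translation whose labels at
    level [n] are [a] at site [0] and [b] at the sites [n!] and [2 n!].

    [G] is invariably generated because it is solvable.  Indeed let [H] meet
    all conjugacy classes of [G], and suppose that [G = N H] where [N] is
    normal and [[N, N]] is contained in [N'].  If [x] is in [N], some [x^g]
    is in [H]; writing [g = u h] with [u] in [N] and [h] in [H] gives [x^u]
    in [H], and [x] equals [x^u] up to the commutator [[x, u]], so that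
    [G = N' H].  Descending along an abelian series gives [G = H]
    ([invariably_generated_series]).

    [G] is not finitely invariably generated.  At level [n] it acts on the
    sections [x : Z -> {0,1,2}] that take the value [0] almost everywhere.
    - The action on them is transitive ([finsupp_orbit]): the commutator of
      [s] with its translate by [n!] has the 3-cycle [[b, a]] as its label at
      one site and trivial labels at the others.
    - A given [w] in [G] fixes one of them as soon as [n] is large
      ([lamps_fixed_section]).  For [n] large, the labels of [w] are given by
      powers of [a] near [0] and by the same powers of [b] near [n!] and near
      [2 n!] ([label_lamps]).  If [w] translates by [m > 0] and [m] divides
      [n!], then a fixed section is obtained by following each class mod [m]
      upwards: the value is [0] until past the sites near [0], since [a] fixes
      [0]; it has become [b^c(0)] past the sites near [n!], where [c] is the
      total exponent on the class, and is back to [b^c(b^c(0)) = 0] past those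
      near [2 n!].  The case [m < 0] is symmetric, and if [m = 0] a fixed point
      of each label is chosen.
    Hence, given finitely many elements of [G], for [n] large each of them has
    a conjugate in the stabiliser of the zero section, which is a proper
    subgroup. *)

(** * Generated subgroups and invariable generation *)

Section Generation.
Context {G : groupType}.
Implicit Types (S H : set G) (x y g : G).

Lemma generated_closed S : group_closed [in generated S].
Proof.
split; rewrite ?inE; first by move=> H [[] + _] _; rewrite inE.
move=> x y; rewrite !inE => xS yS H HS; have [[_ HF] _] := HS.
by have := HF x y; rewrite !inE; apply; [apply: xS | apply: yS].
Qed.

Lemma generated1 S : generated S 1.
Proof. by have [] := generated_closed S; rewrite inE. Qed.

Lemma generatedF S x y : generated S x -> generated S y -> generated S (x / y).
Proof. by have [_ /(_ x y)] := generated_closed S; rewrite !inE. Qed.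

Lemma generatedV S x : generated S x -> generated S x^-1.
Proof.
by move=> Sx; rewrite -div1g; apply: generatedF => //; apply: generated1.
Qed.

Lemma generatedM S x y : generated S x -> generated S y -> generated S (x * y).
Proof.
by move=> Sx Sy; rewrite -[y]invgK; apply: generatedF => //; apply: generatedV.
Qed.

Lemma generatedJ S x y : generated S x -> generated S y -> generated S (x ^ y).
Proof.
move=> Sx Sy; rewrite conjgE; apply: generatedM; first exact: generatedV.
exact: generatedM.
Qed.

Lemma generatedR S x y : generated S x -> generated S y -> generated S [~ x, y].
Proof.
move=> Sx Sy; rewrite commgEl; apply: generatedM; first exact: generatedV.
exact: generatedJ.
Qed.

Lemma generatedX S x n : generated S x -> generated S (x ^+ n).
Proof.
move=> Sx; elim: n => [|n IH]; first by rewrite expg0; apply: generated1.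
by rewrite expgS; apply: generatedM.
Qed.

Lemma sub_generated S : S `<=` generated S.
Proof. by move=> x Sx H [_]; apply. Qed.

Lemma generated_ind S H :
  H 1 -> (forall x y, H x -> H y -> H (x / y)) -> S `<=` H ->
  generated S `<=` H.
Proof.
move=> H1 HF SH x; apply; split=> //; split; rewrite ?inE //.
by move=> y z; rewrite !inE; apply: HF.
Qed.

(** A solvable group is invariably generated.  Solvability is expressed by a
    descending series of subsets from [G] to [1], each closed under inverses
    and with its commutators in the next one. *)
Lemma invariably_generated_series (N : nat -> set G) d :
    (forall x, N 0 x) -> (forall x, N d x -> x = 1) ->
    (forall i x, N i x -> N i x^-1) ->
    (forall i x y, N i x -> N i y -> N i.+1 [~ x, y]) ->
  invariably_generated G.
Proof.
move=> N0 Nd NV NR; exists setT => g; apply/seteqP; split=> // x _.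
set H := generated _.
have conjH y : exists h, H (y ^ h).
  by exists (g y); apply: sub_generated; exists y.
(* G = H * N i for all i *)
have dec i y : exists2 h, H h & N i (h^-1 * y).
  elim: i y => [|i IH] y; first by exists 1; [exact: generated1 | exact: N0].
  have NinH z : N i z -> exists2 h, H h & N i.+1 (h^-1 * z).
    move=> Nz; have [k Hk] := conjH z; have [h Hh Nh] := IH k^-1.
    (* k = u * h^-1 with u in N i and h in H, so that z ^ u is in H as well *)
    set u := (h^-1 * k^-1)^-1.
    have Nu : N i u by apply: NV.
    have ku : k = u * h^-1 by rewrite /u invgM !invgK mulgK.
    exists (z ^ u).
      have -> : z ^ u = (z ^ k) ^ h by rewrite ku -conjgM mulgVK.
      exact: generatedJ.
    have -> : (z ^ u)^-1 * z = [~ z, u]^-1 by rewrite [in RHS]invgM invgK.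
    by apply: NV; apply: NR.
  have [h Hh Nh] := IH y; have [k Hk Nk] := NinH _ Nh.
  by exists (h * k); [exact: generatedM | rewrite invgM -mulgA].
have [h Hh /Nd hx] := dec d x.
by rewrite -(mulVKg h x) hx mulg1.
Qed.

(** If the elements of [G] are each conjugate into all but finitely many of the
    proper subgroups [M n], then finitely many of them are conjugate into a
    common one. *)
Lemma not_finitely_invariably_generated (M : nat -> set G) :
    (forall n, M n 1) -> (forall n x y, M n x -> M n y -> M n (x / y)) ->
    (forall n, M n <> setT) ->
    (forall x, exists m, forall n, m <= n -> exists g, M n (x ^ g)) ->
  ~ finitely_invariably_generated G.
Proof.
move=> M1 MF MT /choice[m Mm] [S /finite_seqP[r ->] Sgen].
pose n := \max_(x <- r) m x.
have {Mm} /choice[g Mg] x : exists g, x \in r -> M n (x ^ g).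
  have [xr | _] := boolP (x \in r); last by exists 1.
  by have [|g ?] := Mm x n; [apply: leq_bigmax_seq | exists g].
apply: (MT n); apply/seteqP; split=> // x _.
have : generated [set s ^ g s | s in [set` r]] x by rewrite (Sgen g).
move: x.
apply: generated_ind; [exact: M1 | exact: MF | move=> _ [s /= sr <-]].
exact: Mg.
Qed.

End Generation.

(** The subgroup of [W] generated by [S], as a group in its own right. *)
Section GeneratedGroup.
Variables (W : groupType) (S : set W).

Record gen_group := GenGroup {gen_val : W; _ : gen_val \in generated S}.

HB.instance Definition _ := [isSub for gen_val].
HB.instance Definition _ := [Choice of gen_group by <:].
HB.instance Definition _ :=
  SubChoice_isSubGroup.Build W [in generated S] gen_group (generated_closed S).

Lemma gen_groupP (u : gen_group) : generated S (val u).
Proof. by have := valP u; rewrite inE. Qed.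

Lemma gen_group_lift w : generated S w -> exists u : gen_group, val u = w.
Proof. by rewrite -in_setE => Sw; exists (GenGroup Sw). Qed.

Lemma gen_group_finitely_generated :
  finite_set S -> finitely_generated gen_group.
Proof.
move=> Sfin; exists (val @^-1` S).
  by apply: finite_preimage => // u v _ _; apply: val_inj.
apply/seteqP; split=> // u _.
suff: generated S `<=` [set w | exists2 v : gen_group,
    generated (val @^-1` S) v & val v = w].
  by move=> /(_ _ (gen_groupP u)) [v Sv /val_inj <-].
apply: generated_ind.
- by exists 1; [exact: generated1 | exact: val1].
- move=> _ _ [u1 S1 <-] [u2 S2 <-]; exists (u1 / u2).
    exact: generatedF.
  by rewrite gmulfF.
- move=> w Sw; have [v vw] := gen_group_lift (sub_generated Sw).
  by exists v => //; apply: sub_generated => /=; rewrite vw.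
Qed.

End GeneratedGroup.

(** * The wreath product of S_3 by the integers, over countably many levels *)

(** The element with translation [shift] and labels [label n j], at level [n]
    and site [j], acts at level [n] by [(j, y) |-> (j + shift, label n j y)].
    Products act from left to right, as for permutations. *)
Record wreath := Wreath {shift : int; label : nat -> int -> 'S_3}.

HB.instance Definition _ := gen_eqMixin wreath.
HB.instance Definition _ := gen_choiceMixin wreath.

Lemma wreathP v w :
  shift v = shift w -> (forall n j, label v n j = label w n j) -> v = w.
Proof.
case: v w => [m k] [m' k'] /= -> kk'; congr Wreath.
by apply/funext => n; apply/funext.
Qed.

Definition wreath_one := Wreath 0 (fun _ _ => 1).
Definition wreath_inv w :=
  Wreath (- shift w)%R (fun n j => (label w n (j - shift w)%R)^-1).
Definition wreath_mul v w := Wreath (shift v + shift w)%R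
  (fun n j => label v n j * label w n (j + shift v)%R).

Lemma wreath_mulA : associative wreath_mul.
Proof.
move=> u v w; apply: wreathP => [|n j] /=; first exact: GRing.addrA.
by rewrite mulgA GRing.addrA.
Qed.

Lemma wreath_mul1g : left_id wreath_one wreath_mul.
Proof.
move=> w; apply: wreathP => [|n j] /=; first exact: GRing.add0r.
by rewrite mul1g GRing.addr0.
Qed.

Lemma wreath_mulg1 : right_id wreath_one wreath_mul.
Proof.
by move=> w; apply: wreathP => [|n j] /=; rewrite ?mulg1 ?GRing.addr0.
Qed.

Lemma wreath_mulVg : left_inverse wreath_one wreath_inv wreath_mul.
Proof.
by move=> w; apply: wreathP => [|n j] /=; rewrite ?mulVg ?GRing.addNr.
Qed.

Lemma wreath_mulgV : right_inverse wreath_one wreath_inv wreath_mul.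
Proof.
move=> w; apply: wreathP => [|n j] /=; first exact: GRing.addrN.
by rewrite GRing.addrK mulgV.
Qed.

HB.instance Definition _ := isGroup.Build wreath
  wreath_mulA wreath_mul1g wreath_mulg1 wreath_mulVg wreath_mulgV.

Lemma shiftM v w : shift (v * w) = (shift v + shift w)%R. Proof. by []. Qed.
Lemma shiftV w : shift w^-1 = (- shift w)%R. Proof. by []. Qed.
Lemma labelM v w n j :
  label (v * w) n j = label v n j * label w n (j + shift v)%R.
Proof. by []. Qed.
Lemma labelV w n j : label w^-1 n j = (label w n (j - shift w)%R)^-1.
Proof. by []. Qed.
Lemma label1 n j : label 1 n j = 1. Proof. by []. Qed.

Lemma even_perm3_commute (p q : 'S_3) : ~~ odd_perm p -> ~~ odd_perm q ->
  p * q = q * p.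
Proof.
have prA : prime #|alt.Alt 'I_3|.
  have := @alt.card_Alt 'I_3; rewrite card_ord => /(_ isT) cardA.
  by have -> : #|alt.Alt 'I_3| = 3 by apply: double_inj; rewrite -mul2n cardA.
have := @cyclic.prime_cyclic _ (alt.Alt_group 'I_3) prA.
move=> /cyclic.cyclic_abelian/centsP cA.
by rewrite -!alt.Alt_even => pA qA; apply: cA.
Qed.

(** The series [W > {shift = 0} > {shift = 0, even labels} > 1] has abelian
    factors. *)
Definition wreath_series (i : nat) (w : wreath) : Prop :=
  match i with
  | 0 => True
  | 1 => shift w = 0%R
  | 2 => shift w = 0%R /\ forall n j, ~~ odd_perm (label w n j)
  | _ => w = 1
  end.

Lemma wreath_seriesV i w : wreath_series i w -> wreath_series i w^-1.
Proof.
case: i => [|[|[|i]]] //; rewrite /wreath_series.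
- by rewrite shiftV => ->; rewrite GRing.oppr0.
- rewrite shiftV => -[-> we]; split=> [|n j]; first by rewrite GRing.oppr0.
  by rewrite labelV odd_permV we.
- by move=> ->; rewrite invg1.
Qed.

Lemma shiftR v w : shift [~ v, w] = 0%R.
Proof. by rewrite /commg !(shiftM, shiftV); lia. Qed.

Lemma labelR v w n j : shift v = 0%R -> shift w = 0%R ->
  label [~ v, w] n j = [~ label v n j, label w n j].
Proof.
move=> v0 w0; rewrite /commg !(labelM, labelV, shiftM, shiftV) v0 w0.
by rewrite !(GRing.oppr0, GRing.addr0).
Qed.

Lemma wreath_seriesR i v w :
  wreath_series i v -> wreath_series i w -> wreath_series i.+1 [~ v, w].
Proof.
case: i => [|[|[|i]]]; rewrite /wreath_series.
- by move=> _ _; apply: shiftR.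
- move=> v0 w0; split=> [|n j]; first exact: shiftR.
  rewrite labelR // /commg !odd_permM !odd_permV.
  by case: odd_perm; case: odd_perm.
- move=> [v0 ve] [w0 we]; apply: wreathP => [|n j]; first exact: shiftR.
  by rewrite labelR //; apply/eqP/commgP; apply: even_perm3_commute.
- by move=> -> _; rewrite comm1g.
Qed.

Lemma wreath_subgroup_invariably_generated (S : set wreath) :
  invariably_generated (gen_group S).
Proof.
pose N i := [set u : gen_group S | wreath_series i (val u)].
apply: (@invariably_generated_series _ N 3) => [//|u|i u|i u v].
- by move=> u1; apply: val_inj; rewrite val1; apply: u1.
- by move/wreath_seriesV; rewrite -gmulfV.
- by move=> Nu /(wreath_seriesR Nu); rewrite -gmulfR.
Qed.

(** * Sections fixed by lamp configurations *)

(** The points [0], [1] and [2]. *)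
Definition p0 : 'I_3 := @Ordinal 3 0 isT.
Definition p1 : 'I_3 := @Ordinal 3 1 isT.
Definition p2 : 'I_3 := @Ordinal 3 2 isT.

Lemma ord3P (y : 'I_3) : [\/ y = p0, y = p1 | y = p2].
Proof.
case: y => [[|[|[|]]]] // lt_y3.
- by constructor 1; apply: val_inj.
- by constructor 2; apply: val_inj.
- by constructor 3; apply: val_inj.
Qed.

(** The involutions [(1 2)] and [(0 1)]. *)
Definition ta : 'S_3 := tperm p1 p2.
Definition tb : 'S_3 := tperm p0 p1.

(** Three copies of the configuration [e]: one with [ta] around [0], and two
    with [tb] around [L] and [2 * L]. *)
Definition lamps (e : int -> bool) (L : nat) (j : int) : 'S_3 :=
  ta ^+ e j * (tb ^+ e (j - L%:Z)%R * tb ^+ e (j - (2 * L)%:Z)%R).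

(** [e] vanishes outside [[-R, R]]. *)
Definition supported R (e : int -> bool) := forall j, R < absz j -> e j = false.

(** The three copies do not interact when [e] and [e'] have small support, so
    that [lamps] turns products into sums mod 2. *)
Lemma lamps_div R e e' L j : supported R e -> supported R e' -> 2 * R < L ->
  lamps e L j / lamps e' L j = lamps (fun i => e i (+) e' i) L j.
Proof.
move=> eR e'R RL.
have X (x : 'S_3) (u v : bool) : x * x = 1 -> x ^+ u / x ^+ v = x ^+ (u (+) v).
  move=> xx; have xV : x^-1 = x by apply: mulg1_eq.
  by case: u; case: v; rewrite /= ?expg0 ?expg1 ?invg1 ?mulg1 ?mul1g // xV.
have aa : ta * ta = 1 := tperm2 _ _.
have bb : tb * tb = 1 := tperm2 _ _.
have Z i : R < absz i -> (e i = false) * (e' i = false).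
  by move=> Ri; split; [apply: eR | apply: e'R].
(* as 2 * R < L, at most one of the three factors is nontrivial at j *)
have Z2 : absz (j - L%:Z)%R <= R \/ absz j <= R ->
    (e (j - (2 * L)%:Z)%R = false) * (e' (j - (2 * L)%:Z)%R = false).
  by move=> jR; apply: Z; lia.
rewrite /lamps.
have [jR|jR] := leqP (absz j) R.
  have [-> ->] : (e (j - L%:Z)%R = false) * (e' (j - L%:Z)%R = false).
    by apply: Z; lia.
  by rewrite !(Z2 (or_intror jR)) !expg0 !mulg1 X.
have [-> ->] := Z _ jR.
have [jL|jL] := leqP (absz (j - L%:Z)%R) R.
  by rewrite !(Z2 (or_introl jL)) !expg0 !mulg1 !mul1g X.
have [-> ->] := Z _ jL.
by rewrite !expg0 !mul1g X.
Qed.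

(** The graph of [x] is invariant under [(j, y) |-> (j + m, k j y)]. *)
Definition section_fixed m (k : int -> 'S_3) (x : int -> 'I_3) :=
  forall j, k j (x j) = x (j + m)%R.

(** [x] takes the value [p0] outside [[-R, R]]. *)
Definition finsupp R (x : int -> 'I_3) := forall j, R < absz j -> x j = p0.

(** [D j] is the parity of the number of lamps, out of those around [L] minus
    those around [2 * L], met before [j] when moving from one end of [Z] by
    steps of [m].  It vanishes outside the range of the lamps because [m]
    divides [L], so that the lamps of the two groups lie in the same classes
    mod [m] and cancel. *)
Lemma telescoping_lamps R e L (m : int) :
    supported R e -> 2 * R < L -> m != 0%R -> absz m %| L ->
  exists2 D : int -> bool,
    forall j, D (j + m)%R = D j (+) (e (j - L%:Z)%R (+) e (j - (2 * L)%:Z)%R)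
    & forall j, D j -> (L%:Z - R%:Z <= j <= (2 * L)%:Z + R%:Z)%R.
Proof.
move=> eR RL m0 /dvdnP[q Lq].
(* F j - F (j - |m|) telescopes; D is F, or F (. - m) when m is positive *)
pose F j := \big[addb/false]_(0 <= i < q) e (j - L%:Z - (i * absz m)%:Z)%R.
have q0 : 0 < q by case: q Lq F => [|q] //; lia.
have FS j : F (j - (absz m)%:Z)%R =
    F j (+) (e (j - L%:Z)%R (+) e (j - (2 * L)%:Z)%R).
  pose f i := e (j - L%:Z - (i * absz m)%:Z)%R.
  have -> : e (j - L%:Z)%R = f 0 by congr e; lia.
  have -> : e (j - (2 * L)%:Z)%R = f q by congr e; lia.
  rewrite (_ : F j = \big[addb/false]_(0 <= i < q) f i) //.
  rewrite (_ : F _ = \big[addb/false]_(0 <= i < q) f i.+1); last first.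
    by apply: eq_bigr => i _; congr e; lia.
  elim: q {Lq q0 F} => [|q IH]; first by rewrite !big_nil addbb.
  rewrite !big_nat_recr //= IH.
  by case: (f q); case: (f 0); case: (f q.+1); case: (\big[_/_]_(_ <= _ < _) _).
have Fsupp j : F j -> (L%:Z - R%:Z <= j <= (2 * L)%:Z + R%:Z - (absz m)%:Z)%R.
  apply: contraTT => jout; rewrite /F big_nat big1 // => i /andP[_ iq].
  have : i.+1 * absz m <= q * absz m by rewrite leq_mul2r iq orbT.
  by move=> im; apply: eR; move: jout; rewrite Lq mulSn in RL im *; lia.
have [m_gt0 | m_le0] := boolP (0 < m)%R.
  exists (fun j => F (j - m)%R) => j.
    rewrite GRing.addrK.
    have := FS j; have -> : (absz m)%:Z%R = m by lia.
    by move=> ->; rewrite -addbA addbb addbF.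
  by move/Fsupp; lia.
exists F => j; last by move/Fsupp; lia.
have -> : m = (- (absz m)%:Z)%R by lia.
exact: FS.
Qed.

Lemma lamps_fixed_section R e L (m : int) : supported R e -> 2 * R < L ->
    (m != 0%R -> absz m %| L) ->
  exists R' (x : int -> 'I_3),
    finsupp R' x /\ section_fixed m (lamps e L) x.
Proof.
move=> eR RL mL.
have a0 : ta p0 = p0 by rewrite tpermD.
have b2 : tb p2 = p2 by rewrite tpermD.
have [m0 | m0] := eqVneq m 0%R.
  (* ta fixes p0 and tb fixes p2 *)
  exists (2 * L + R), (fun j =>
    if e (j - L%:Z)%R || e (j - (2 * L)%:Z)%R then p2 else p0).
  split=> j; first by move=> Rj; rewrite !eR //; lia.
  rewrite m0 GRing.addr0 /lamps !permM.
  have eX (x : 'S_3) (u : bool) y : x y = y -> (x ^+ u) y = y.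
    by case: u => xy; rewrite ?expg1 // expg0 perm1.
  case: ifP => [e12 | /norP[/negbTE-> /negbTE->]].
    have -> : e j = false.
      apply: contraTF e12 => ej; have jR : absz j <= R.
        by rewrite leqNgt; apply/negP => /eR; rewrite ej.
      by rewrite !eR //; lia.
    by rewrite expg0 perm1 !eX.
  by rewrite !expg0 !perm1 eX.
have [D DS Dsupp] := telescoping_lamps eR RL m0 (mL m0).
(* the value p0 changes only between the lamps around L and those around 2L *)
exists (2 * L + R), (fun j => (tb ^+ D j) p0); split=> j.
  move=> Rj; have -> : D j = false by apply/negP => /Dsupp; lia.
  by rewrite expg0 perm1.
rewrite DS /lamps !permM.
have [ej | ] := boolP (e j).
  have jR : absz j <= R by rewrite leqNgt; apply/negP => /eR; rewrite ej.
  have -> : D j = false by apply/negP => /Dsupp; lia.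
  rewrite !(eR (j - _)%R); try lia.
  by rewrite expg1 !expg0 !perm1 a0.
rewrite expg0 perm1 -!permM => _.
have bb : tb * tb = 1 := tperm2 _ _.
apply: (congr1 (fun p : 'S_3 => p p0)).
by case: (D j); case: (e _); case: (e _);
  rewrite /= ?expg0 ?expg1 ?mulg1 ?mul1g ?mulgA ?bb ?mul1g.
Qed.

(** * The two-generated group *)

(** The translation by [z], with trivial labels. *)
Definition translation (z : int) : wreath := Wreath z (fun _ _ => 1).

(** At level [n]: [ta] at site [0], [tb] at the sites [n!] and [2 * n!]. *)
Definition lamplighter : wreath :=
  Wreath 0 (fun n => lamps (fun i => i == 0%R) n`!).
Definition gens : set wreath := [set lamplighter; translation 1].

Lemma generated_translation z : generated gens (translation z).
Proof.
have genN k : generated gens (translation k%:Z%R).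
  elim: k => [|k IH]; first exact: generated1.
  have -> : translation (k.+1)%:Z%R = translation k%:Z%R * translation 1.
    by apply: wreathP => [|n j]; rewrite ?labelM ?mulg1 //= ; lia.
  by apply: generatedM => //; apply: sub_generated; right.
case: z => k; first exact: genN.
have -> : translation (Negz k) = (translation k.+1%:Z%R)^-1.
  by apply: wreathP => [|n j]; rewrite ?labelV ?invg1 //= ; lia.
exact: generatedV.
Qed.

Lemma generated_lamplighter : generated gens lamplighter.
Proof. by apply: sub_generated; left. Qed.

Lemma shift_conj w z : shift w = 0%R -> shift (w ^ translation z) = 0%R.
Proof.
by move=> w0; rewrite /conjg !(shiftM, shiftV) w0 GRing.add0r GRing.addNr.
Qed.

Lemma label_conj w z n j : shift w = 0%R ->
  label (w ^ translation z) n j = label w n (j - z)%R.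
Proof.
move=> w0; rewrite /conjg !(labelM, labelV, shiftM, shiftV) /=.
by rewrite invg1 mul1g mulg1.
Qed.

(** At all levels but finitely many, the labels of an element of the group form
    a configuration of lamps which depends on the level only through the scale
    [n!]. *)
Lemma label_lamps w : generated gens w -> exists R e N, supported R e /\
  forall n, N <= n -> forall j, label w n j = lamps e n`! j.
Proof.
move: w; apply: generated_ind => [|v w|w [|] ->].
- exists 0, (fun _ => false), 0; split=> // n _ j.
  by rewrite /lamps !expg0 !mulg1.
- move=> [Rv [ev [Nv [Sv Lv]]]] [Rw [ew [Nw [Sw Lw]]]].
  pose d := (shift v - shift w)%R; pose R := Rv + Rw + absz d.
  have Sv' : supported R ev by move=> j Rj; apply: Sv; rewrite /R in Rj; lia.
  have Sw' : supported R (fun i => ew (i + d)%R).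
    by move=> j Rj; apply: Sw; rewrite /R in Rj; lia.
  exists R, (fun i => ev i (+) ew (i + d)%R), (maxn (maxn Nv Nw) (2 * R).+1).
  split=> [j Rj|n]; first by rewrite Sv' ?Sw'.
  rewrite !geq_max => /andP[/andP[Nvn Nwn] Rn] j.
  rewrite -(lamps_div j Sv' Sw'); last exact: leq_trans (fact_geq n).
  rewrite labelM labelV Lv // Lw // -GRing.addrA -/d.
  by rewrite /lamps !(GRing.addrAC j d).
- exists 0, (fun i => i == 0%R), 0; split=> // j Rj.
  by apply/eqP => j0; rewrite j0 in Rj.
- exists 0, (fun _ => false), 0; split=> // n _ j.
  by rewrite /lamps !expg0 !mulg1.
Qed.

Lemma ta_tbE : ((ta p0 = p0) * (ta p1 = p2) * (ta p2 = p1)) *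
  ((tb p0 = p1) * (tb p1 = p0) * (tb p2 = p2)).
Proof. by rewrite /ta /tb !(tpermL, tpermR) !tpermD. Qed.

(** The group acts transitively on the three points over a given site, by
    elements without translation and with trivial labels at the other sites. *)
Lemma single_site n i y : exists w, [/\ generated gens w, shift w = 0%R,
  label w n i p0 = y & forall j, j != i -> label w n j = 1].
Proof.
pose L := n`!; have L0 : 0 < L := fact_gt0 n.
(* the supports {0, L, 2L} and {L, 2L, 3L} of lamplighter and of its translate
   share L, where the labels are tb and ta, and 2L, where both are tb *)
pose u := [~ lamplighter, lamplighter ^ translation L%:Z%R].
have su : shift u = 0%R by apply: shiftR.
have lu j : label u n j = if j == L%:Z%R then [~ tb, ta] else 1.
  rewrite labelR ?shift_conj // label_conj // /label /lamplighter /lamps -/L.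
  rewrite (_ : (j - L%:Z == 0)%R = (j == L%:Z%R)); last by lia.
  rewrite (_ : (j - L%:Z - L%:Z == 0)%R = (j == (2 * L)%:Z%R)); last by lia.
  rewrite (_ : (j - (2 * L)%:Z == 0)%R = (j == (2 * L)%:Z%R)); last by lia.
  rewrite (_ : (j - L%:Z - (2 * L)%:Z == 0)%R = (j == (3 * L)%:Z%R));
    last by lia.
  by do 4![case: eqP => ?]; try (exfalso; lia);
    rewrite ?(expg0, expg1, mul1g, mulg1, comm1g, commg1, commgg).
have gu : generated gens u.
  apply: generatedR; first exact: generated_lamplighter.
  apply: generatedJ; first exact: generated_lamplighter.
  exact: generated_translation.
clearbody u.
have [m cm] : exists m, ([~ tb, ta] ^+ m) p0 = y.
  have c01 : [~ tb, ta] p0 = p1.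
    by rewrite /commg !permM !tpermV -/ta -/tb !ta_tbE.
  have c12 : [~ tb, ta] p1 = p2.
    by rewrite /commg !permM !tpermV -/ta -/tb !ta_tbE.
  case: (ord3P y) => ->; [exists 0%N|exists 1%N|exists 2%N].
  - by rewrite expg0 perm1.
  - by rewrite expg1.
  - by rewrite expgS expg1 permM c01.
have lum j : label (u ^+ m) n j = (label u n j) ^+ m /\ shift (u ^+ m) = 0%R.
  elim: m {cm} => [|m [IHl IHs]]; first by rewrite !expg0.
  by rewrite !expgS labelM shiftM su IHs !GRing.addr0 IHl.
have sum : shift (u ^+ m) = 0%R by case: (lum 0%R).
exists ((u ^+ m) ^ translation (i - L%:Z)%R); split=> [|||j ij].
- by apply: generatedJ; [exact: generatedX | exact: generated_translation].
- exact: shift_conj.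
- rewrite label_conj // (lum _).1 lu; case: eqP => [_|]; [exact: cm | lia].
- rewrite label_conj // (lum _).1 lu; case: eqP => [|_]; [lia | exact: expg1n].
Qed.

(** The orbit of the constant section [p0] contains all sections of finite
    support. *)
Lemma finsupp_orbit n R x : finsupp R x -> exists w,
  [/\ generated gens w, shift w = 0%R & forall j, label w n j p0 = x j].
Proof.
move=> xR.
have [r xr] : exists r : seq int, forall j, j \notin r -> x j = p0.
  pose r := iota 0 R.+1.
  exists ([seq k%:Z%R | k <- r] ++ [seq (- k%:Z)%R | k <- r]) => j.
  rewrite mem_cat => /norP[j1 j2]; apply: xR; rewrite ltnNge; apply/negP => jR.
  have [j0|j0] := boolP (0 <= j)%R.
    by move/mapP: j1; apply; exists (absz j); [rewrite mem_iota; lia | lia].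
  by move/mapP: j2; apply; exists (absz j); [rewrite mem_iota; lia | lia].
elim: r x xr {xR} => [|i r IH] x xr.
  by exists 1; split=> [||j]; rewrite ?label1 ?perm1 ?xr //; apply: generated1.
have [|v [gv sv lv]] := IH (fun j => if j == i then p0 else x j).
  by move=> j jr; case: ifPn => // ji; apply: xr; rewrite inE negb_or ji.
have [w [gw sw wi wj]] := single_site n i (x i).
exists (v * w); split=> [||j]; first exact: generatedM.
  by rewrite shiftM sv sw.
rewrite labelM sv GRing.addr0 permM lv.
by case: (eqVneq j i) => [->|/wj ->]; rewrite ?perm1.
Qed.

(** Stabiliser of the constant section [p0] at level [n]. *)
Definition stab n := [set w : wreath | forall j, label w n j p0 = p0].

Lemma stabF n v w : stab n v -> stab n w -> stab n (v / w).
Proof.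
move=> Sv Sw j; rewrite labelM labelV permM Sv.
by rewrite -{1}(Sw (j + shift v - shift w)%R) permK.
Qed.

Lemma conj_stab w : generated gens w -> exists N, forall n, N <= n ->
  exists2 g, generated gens g & stab n (w ^ g).
Proof.
move=> gw; have [R [e [N [eR we]]]] := label_lamps gw.
exists (maxn N (maxn (2 * R).+1 (absz (shift w)))) => n.
rewrite !geq_max => /and3P[Nn Rn wn].
have dvd : shift w != 0%R -> absz (shift w) %| n`!.
  by move=> w0; apply: dvdn_fact; lia.
have RL : 2 * R < n`! by exact: leq_trans (fact_geq n).
have [R' [x [xR xfix]]] := lamps_fixed_section eR RL dvd.
have [v [gv sv lv]] := finsupp_orbit n xR.
exists v^-1; first exact: generatedV.
move=> j; rewrite conjgE invgK !labelM labelV !permM sv !GRing.addr0 lv.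
by rewrite we // xfix -lv permK.
Qed.

Lemma gens_not_finitely_invariably_generated :
  ~ finitely_invariably_generated (gen_group gens).
Proof.
pose M n := [set u : gen_group gens | stab n (val u)].
apply: (@not_finitely_invariably_generated _ M).
- by move=> n j; rewrite perm1.
- by move=> n u v Su Sv; have := stabF Su Sv; rewrite -gmulfF.
- move=> n; have [w [gw _ wp _]] := single_site n 0%R p1.
  have [u uw] := gen_group_lift gw.
  by move=> /seteqP[_ /(_ u I)/= /(_ 0%R)]; rewrite uw wp.
- move=> u; have [N HN] := conj_stab (gen_groupP u).
  exists N => n /HN[g /gen_group_lift[g' <-]].
  by rewrite -gmulfJ => Sg; exists g'.
Qed.

Theorem theorem3 :
  exists G : groupType,
    [/\ finitely_generated G, invariably_generated G
      & ~ finitely_invariably_generated G].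
Proof.
exists (gen_group gens); split.
- exact/gen_group_finitely_generated/finite_set2.
- exact: wreath_subgroup_invariably_generated.
- exact: gens_not_finitely_invariably_generated.
Qed.
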